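(* For every real number $\alpha\ge 4$, the quantity $\chi_o(\mathcal{G}_{\alpha})$ is undefined; that is, the set $\{\chi_o(G) : G\in\mathcal{G}_{\alpha}\}$ has no maximum (it is unbounded).
   Context: All graphs are finite, simple and have at least one vertex. A proper coloring of a graph $G$ is called odd if every non-isolated vertex $v$ has some color that appears an odd number of times on its (open) neighborhood $N(v)$. The smallest number of colors in an odd coloring of $G$ is denoted $\chi_o(G)$. The maximum average degree of $G$ is $\mathrm{mad}(G):=\max_{H\subseteq G}2|E(H)|/|V(H)|$, the maximum being over all non-empty subgraphs $H$ of $G$. For a positive real $\alpha$, $\mathcal{G}_{\alpha}$ denotes the family of all graphs $G$ with $\mathrm{mad}(G)<\alpha$, and $\chi_o(\mathcal{G}_{\alpha})$ denotes the maximum value of $\chi_o(G)$ over all $G\in\mathcal{G}_{\alpha}$, when this maximum exists; otherwise it is undefined. *)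

(* Defs.v *)
From HB Require Import structures.
From mathcomp Require Import all_boot all_order all_algebra.
From mathcomp Require Import reals.

Set Implicit Arguments.
Unset Strict Implicit.
Unset Printing Implicit Defensive.

Import Order.TTheory GRing.Theory Num.Theory.

(* Finite simple graphs with at least one vertex. *)
Record sgraph : Type := SGraph {
  vertex :> finType;
  adj : rel vertex;
  adj_sym : symmetric adj;
  adj_irrefl : irreflexive adj;
  vertex_gt0 : 0 < #|vertex|
}.

Section Graph.
Variable G : sgraph.

Definition neighbors (v : G) : {set G} := [set u | adj v u].

Definition isolated (v : G) : bool := neighbors v == set0.

Definition proper_coloring (k : nat) (f : {ffun G -> 'I_k}) : bool :=
  [forall u, forall v, adj u v ==> (f u != f v)].

Definition odd_coloring (k : nat) (f : {ffun G -> 'I_k}) : bool :=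
  proper_coloring f &&
  [forall v, ~~ isolated v ==>
     [exists c, odd #|[set u in neighbors v | f u == c]|]].

Definition odd_colorable (k : nat) : bool :=
  [exists f : {ffun G -> 'I_k}, odd_coloring f].

Lemma odd_colorable_card : odd_colorable #|G|.
Proof.
apply/existsP; exists [ffun v => enum_rank v]; apply/andP; split.
  apply/forallP=> u; apply/forallP=> v; apply/implyP=> uv.
  by rewrite !ffunE; apply: contraTneq uv => /enum_rank_inj ->; rewrite adj_irrefl.
apply/forallP=> v; apply/implyP=> /set0Pn[u uv].
apply/existsP; exists (enum_rank u).
rewrite (_ : [set _ in _ | _] = [set u]) ?cards1 //.
apply/setP=> w; rewrite !inE ffunE (inj_eq enum_rank_inj).
by case: eqP => [->|]; rewrite ?andbF ?andbT // -in_set.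
Qed.

Lemma ex_odd_colorable : exists k, odd_colorable k.
Proof. by exists #|G|; apply: odd_colorable_card. Qed.

Definition chi_o : nat := ex_minn ex_odd_colorable.

(* Edges are unordered pairs, i.e. two-element sets of vertices. *)
Definition edges : {set {set G}} :=
  [set [set p.1; p.2] | p : G * G & adj p.1 p.2].

(* A non-empty subgraph is a pair H = (V(H), E(H)); it need not be induced. *)
Definition nonempty_subgraph (H : {set G} * {set {set G}}) : bool :=
  [&& H.1 != set0, H.2 \subset edges & [forall e in H.2, e \subset H.1]].

Definition avg_degree (R : realType) (H : {set G} * {set {set G}}) : R :=
  (2 * #|H.2|%:R / #|H.1|%:R)%R.

(* The base value 0 is harmless because average degrees are nonnegative and G
   has a non-empty subgraph: see [mad_attained] and [avg_degree_le_mad]. *)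
Definition mad (R : realType) : R :=
  \big[Num.max/0%R]_(H : {set G} * {set {set G}} | nonempty_subgraph H)
    avg_degree R H.

Lemma avg_degree_le_mad (R : realType) (H : {set G} * {set {set G}}) :
  nonempty_subgraph H -> (avg_degree R H <= mad R)%R.
Proof. by move=> subH; apply: le_bigmax_cond. Qed.

Lemma mad_attained (R : realType) :
  exists2 H, nonempty_subgraph H & mad R = avg_degree R H.
Proof.
have subT : nonempty_subgraph ([set: G], set0).
  rewrite /nonempty_subgraph /= sub0set -cards_eq0 cardsT -lt0n vertex_gt0 /=.
  by apply/forallP=> e; rewrite inE.
rewrite /mad (bigmax_eq_arg _ _ _ _ subT).
  by case: arg_maxP => // H subH _; exists H.
by move=> H _; rewrite /avg_degree mulr_ge0 ?invr_ge0 ?mulr_ge0 ?ler0n.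
Qed.

End Graph.

Definition mad_class (R : realType) (alpha : R) (G : sgraph) : Prop :=
  (mad G R < alpha)%R.

(* chi_o of the class of graphs C is defined and equal to m. *)
Definition is_max_chi_o (C : sgraph -> Prop) (m : nat) : Prop :=
  (exists2 G, C G & chi_o G = m) /\ (forall G, C G -> chi_o G <= m).

(* Main.v *)
Require Import Defs.
From mathcomp Require Import all_boot all_order all_algebra.
From mathcomp Require Import reals.

Set Implicit Arguments.
Unset Strict Implicit.
Unset Printing Implicit Defensive.

Import Order.TTheory GRing.Theory Num.Theory.

(** Subdivide every edge of a complete graph on [n] vertices once. A
    subdivision vertex has exactly two neighbors, so in an odd coloring these
    two must differ: otherwise their common color occurs twice around it and
    every other color not at all. Hence the [n] original vertices receive
    pairwise distinct colors ([ltn_chi_o_subdivision]), and the odd chromatic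
    number is at least [n].

    The maximum average degree nevertheless stays below 4 for every [n]. Each
    edge has exactly one subdivision vertex as an endpoint, and at most two
    edges share it; so a subgraph containing [b] subdivision vertices has at
    most [2 * b] edges. If it has an edge at all, it also contains an original
    vertex, hence more than [b] vertices ([card_subdivision_edges]), and its
    average degree is less than [2 * (2 * b) / b = 4]. The bound 4 does not
    depend on [n], which makes the odd chromatic number unbounded on the class
    of graphs with maximum average degree less than any given [alpha >= 4]. *)

Section Subdivision.
Variable n : nat.

Definition subdivision_vertex : finType := ('I_n.+1 + 'I_n.+1 * 'I_n.+1)%type.

Definition incident (i : 'I_n.+1) (p : 'I_n.+1 * 'I_n.+1) : bool :=
  (i == p.1) || (i == p.2).

Definition subdivision_adj : rel subdivision_vertex := fun x y =>
  match x, y with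
  | inl i, inr p => incident i p
  | inr p, inl i => incident i p
  | _, _ => false
  end.

Lemma subdivision_adj_sym : symmetric subdivision_adj.
Proof. by case=> [i|p] [j|q]. Qed.

Lemma subdivision_adj_irrefl : irreflexive subdivision_adj.
Proof. by case. Qed.

Lemma subdivision_vertex_gt0 : 0 < #|subdivision_vertex|.
Proof. by apply/card_gt0P; exists (inl ord0). Qed.

(** The subdivided complete graph on [n.+1] vertices, with the subdivision
    vertices indexed by all ordered pairs: every edge is doubled before being
    subdivided, and the diagonal pairs [(i, i)] are pendant vertices at [i].
    These additions affect neither of the two estimates and avoid a choice of
    orientation of the edges. *)
Definition subdivision : sgraph :=
  SGraph subdivision_adj_sym subdivision_adj_irrefl subdivision_vertex_gt0.

Lemma neighbors_subdivision (i j : 'I_n.+1) :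
  neighbors (inr (i, j) : subdivision) = [set inl i; inl j].
Proof. by apply/setP=> -[l|q]; rewrite !inE. Qed.

Lemma subdivision_edgeP (e : {set subdivision}) :
  e \in edges subdivision ->
  exists i p, incident i p /\ e = [set inl i; inr p].
Proof.
case/imsetP=> -[[i|p] [j|q]]; rewrite inE //= => adj_xy ->; first by exists i, q.
by exists j, p; rewrite setUC.
Qed.

(** At most two edges meet in each subdivision vertex, which gives the factor
    2; strictness comes from the original vertex on any given edge, or from
    the non-emptiness of [H.1] when there are no edges. *)
Lemma card_subdivision_edges (H : {set subdivision} * {set {set subdivision}}) :
  nonempty_subgraph H -> #|H.2| < 2 * #|H.1|.
Proof.
case: H => V E /and3P[/= V0 /subsetP Eedge /forallP EV].
have {}EV e : e \in E -> e \subset V by move/implyP: (EV e).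
have [->|[e eE]] := set_0Vmem E; first by rewrite cards0 muln_gt0 card_gt0.
pose S : {set subdivision} := [set x in V | if x is inr _ then true else false].
have ltSV : #|S| < #|V|.
  have [i [p [_ def_e]]] := subdivision_edgeP (Eedge e eE).
  have iV : inl i \in V by rewrite (subsetP (EV e eE)) // def_e !inE eqxx.
  apply/proper_card/properP; split.
    by apply/subsetP=> x; rewrite inE => /andP[].
  by exists (inl i); rewrite // inE andbF.
(* The edge at [x] towards the first or the second end of [x]; the value at
   original vertices is arbitrary. *)
pose half_edge (xb : subdivision * bool) : {set subdivision} :=
  if xb.1 is inr p then [set inl (if xb.2 then p.1 else p.2); inr p] else set0.
have subE : E \subset half_edge @: setX S [set: bool].
  apply/subsetP=> e' e'E; have [i [p [ip def_e']]] := subdivision_edgeP (Eedge e' e'E).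
  apply/imsetP; exists (inr p, i == p.1).
    by rewrite !inE !andbT (subsetP (EV e' e'E)) // def_e' !inE eqxx orbT.
  rewrite def_e' /half_edge /=.
  by case/orP: ip => /eqP ->; rewrite ?eqxx //; case: eqP => [->|].
apply: leq_ltn_trans (subset_leq_card subE) _.
apply: leq_ltn_trans (leq_imset_card _ _) _.
by rewrite cardsX cardsT card_bool mulnC ltn_pmul2l.
Qed.

Lemma mad_subdivision_lt4 (R : realType) : (mad subdivision R < 4)%R.
Proof.
have [H subH ->] := mad_attained subdivision R.
have V0 : (0 < #|H.1|%:R :> R)%R.
  by case/and3P: subH => V0 _ _; rewrite ltr0n card_gt0.
rewrite /avg_degree ltr_pdivrMr // -!natrM ltr_nat.
by rewrite -[4%N]/(2 * 2)%N -mulnA ltn_pmul2l // card_subdivision_edges.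
Qed.

(** The subdivision vertex [(i, j)] is what forces [i] and [j] apart. *)
Lemma odd_coloring_subdivision_inj k (f : {ffun subdivision -> 'I_k}) :
  odd_coloring f -> injective (fun i : 'I_n.+1 => f (inl i)).
Proof.
case/andP=> _ /forallP odd_f i j fij; apply/eqP/negPn/negP=> ij.
have /implyP/(_ _)/existsP[|c] := odd_f (inr (i, j)).
  rewrite /isolated neighbors_subdivision; apply/set0Pn.
  by exists (inl i); rewrite !inE eqxx.
rewrite neighbors_subdivision; have [fic|fic] := eqVneq (f (inl i)) c.
  rewrite (_ : [set _ in _ | _] = [set inl i; inl j]).
    by rewrite cards2 (inj_eq (@inl_inj _ _)) ij.
  apply/setP=> x; rewrite !inE; apply/andb_idr.
  by case/orP=> /eqP->; rewrite -?fij fic.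
rewrite (_ : [set _ in _ | _] = set0) ?cards0 //.
apply/setP=> x; rewrite !inE; apply/negP=> /andP[/orP[] /eqP-> fc].
  by rewrite fc in fic.
by rewrite fij fc in fic.
Qed.

Lemma ltn_chi_o_subdivision : n < chi_o subdivision.
Proof.
rewrite /chi_o; case: ex_minnP => k /existsP[f odd_f] _.
have := leq_card _ (odd_coloring_subdivision_inj odd_f).
by rewrite !card_ord.
Qed.

End Subdivision.

Theorem corollary7 (R : realType) (alpha : R) (halpha : (4 <= alpha)%R) :
  ~ (exists m : nat, is_max_chi_o (mad_class alpha) m) /\
  (forall k : nat, exists2 G : sgraph, mad_class alpha G & (k < chi_o G)%N).
Proof.
have unbounded k : exists2 G : sgraph, mad_class alpha G & (k < chi_o G)%N.
  exists (subdivision k); last exact: ltn_chi_o_subdivision.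
  exact: lt_le_trans (mad_subdivision_lt4 k R) halpha.
split=> // -[m [_ max_m]]; have [G madG] := unbounded m.
by rewrite ltnNge max_m.
Qed.
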